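(* Let $\tau>0$, $\eta>0$, $q>0$, and let $g(y)=\sup_{z\in\mathcal Z}\{\langle y,z\rangle-h(z)\}$. The randomized primal-dual scheme $$x_i^{k+1}=\begin{cases}\arg\min_{x_i\in\mathcal X_i}\langle-\bar z^k,A_ix_i\rangle+u_i(x_i)+\frac\tau2\|x_i-x_i^k\|_2^2,&i=i_k,\\ x_i^k,&i\ne i_k,\end{cases}$$ $$z^{k+1}=\arg\min_{z\in\mathcal Z}h(z)+\langle z,Ax^{k+1}\rangle+\frac\eta2\|z-z^k\|_2^2,\qquad\bar z^{k+1}=q(z^{k+1}-z^k)+z^{k+1},$$ is equivalent to the updates $$x_i^{k+1}=\begin{cases}\arg\min_{x_i\in\mathcal X_i}\langle-z^k,A_ix_i\rangle+u_i(x_i)+\frac{q}{2\eta}\|A_i(x_i-x_i^k)+r^k\|^2+\frac12\|x_i-x_i^k\|^2_{\tau I-\frac q\eta A_i^\top A_i},&i=i_k,\\ x_i^k,&i\ne i_k,\end{cases}$$ $$y^{k+1}=\arg\min_yg(y)-\langle y,z^k\rangle+\frac1{2\eta}\|y+Ax^{k+1}\|^2,\qquad z^{k+1}=z^k-\frac1\eta(Ax^{k+1}+y^{k+1}),$$ where $r^k=Ax^k+y^k$; that is, with the same selected indices $i_k$ and matching initialization ($\bar z^0=z^0-\frac q\eta(Ax^0+y^0)$), the two schemes generate the same sequences $\{x^k\}$ and $\{z^k\}$. Therefore, the scheme is a special case of the RPDBU algorithm of the context (with multiplier $\lambda^k=z^k$) applied to $$\min_{x\in\mathcal X,\,y}\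 \sum_{i=1}^Nu_i(x_i)+g(y)\quad\text{s.t. }Ax+y=0,$$ with the setting $I_k=\{i_k\}$, $\rho_x=\frac q\eta$, $\rho_y=\rho=\frac1\eta$, $P^k=\tau I-\frac q\eta A_{i_k}^\top A_{i_k}$ and $Q^k=0$ for all $k$.
   Context: Here $x=(x_1;\dots;x_N)$, $A=(A_1,\dots,A_N)$ (so $Ax=\sum_iA_ix_i$), $\mathcal X=\mathcal X_1\times\cdots\times\mathcal X_N$ with $\mathcal X_i$ closed convex, $\mathcal Z$ is a closed convex set, the $u_i$ and $h$ are proper closed convex functions (with $h+\iota_{\mathcal Z}$ proper, $\iota_{\mathcal Z}$ being the indicator function of $\mathcal Z$); $g$ is thus the convex conjugate of $h+\iota_{\mathcal Z}$. The first scheme is a method for the saddle-point problem $\min_{z\in\mathcal Z}\{h(z)+\max_{x\in\mathcal X}\langle z,\sum_iA_ix_i\rangle-\sum_iu_i(x_i)\}$, where at each iteration $i_k\in\{1,\dots,N\}$ is a block selected uniformly at random. $\|w\|_W^2:=w^\top Ww$ for symmetric $W$. RPDBU algorithm, for a problem $\min f(x)+\sum_iu_i(x_i)+g_0(y)+v(y)$ s.t. $Ax+By=b$, $x\in\mathcal X$, $y\in\mathcal Y$, with $f,g_0$ smooth convex, and $y$ treated as a single block (always updated): with $r^0=Ax^0+By^0-b$, for $k=0,1,\dots$ select a random $I=I_k\subset\{1,\dots,N\}$ of fixed cardinality $n$ uniformly, keep $x_i^{k+1}=x_i^k$ for $i\notin I_k$, and set (with sub-vectors, sub-matrices etc. indexed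 by $I$) $$x_I^{k+1}=\arg\min_{x_I\in\mathcal X_I}\langle\nabla_If(x^k)-A_I^\top\lambda^k,x_I\rangle+\sum_{i\in I}u_i(x_i)+\tfrac{\rho_x}2\|A_I(x_I-x_I^k)+r^k\|^2+\tfrac12\|x_I-x_I^k\|_{P^k}^2,$$ $$r^{k+\frac12}=r^k+A_I(x_I^{k+1}-x_I^k),$$ $$y^{k+1}=\arg\min_{y\in\mathcal Y}\langle\nabla g_0(y^k)-B^\top\lambda^k,y\rangle+v(y)+\tfrac{\rho_y}2\|B(y-y^k)+r^{k+\frac12}\|^2+\tfrac12\|y-y^k\|_{Q^k}^2,$$ $$r^{k+1}=r^{k+\frac12}+B(y^{k+1}-y^k),\qquad\lambda^{k+1}=\lambda^k-\rho\,r^{k+1}.$$ In the proposition $f=0$, $g_0=0$, $v=g$, $B=I$, $b=0$, $n=1$, and $\mathcal Y$ is the whole space. *)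

(* Defs.v *)
From HB Require Import structures.
From mathcomp Require Import all_boot all_order all_algebra.
From mathcomp Require Import all_classical all_reals all_analysis.

Set Implicit Arguments.
Unset Strict Implicit.
Unset Printing Implicit Defensive.

Import Order.TTheory GRing.Theory Num.Theory.
Import numFieldNormedType.Exports.

Local Open Scope classical_set_scope.
Local Open Scope ring_scope.

(* Euclidean structure on column vectors (the library norm on matrices is the
   sup norm). *)
Definition dot (R : realType) (n : nat) (v w : 'cV[R]_n) : R :=
  (v^T *m w) ord0 ord0.

Definition sqnorm (R : realType) (n : nat) (w : 'cV[R]_n) : R := dot w w.

Definition wsqnorm (R : realType) (n : nat) (W : 'M[R]_n) (w : 'cV[R]_n) : R :=
  (w^T *m W *m w) ord0 ord0.

(* Convexity and closedness of an extended-valued function are those of its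
   epigraph. *)
Definition epigraph (R : realType) (n : nat) (f : 'cV[R]_n -> \bar R) :
    set ('cV[R]_n * R^o) :=
  [set xt | (f xt.1 <= (xt.2 : R)%:E)%E].

Definition proper_ext (R : realType) (n : nat) (f : 'cV[R]_n -> \bar R) : Prop :=
  (forall x, f x <> -oo%E) /\ (exists x, f x <> +oo%E).

Definition closed_convex_set (R : realType) (n : nat) (S : set 'cV[R]_n) : Prop :=
  closed S /\ convex_set (S : set (convex_lmodType 'cV[R]_n)).

Definition proper_closed_convex (R : realType) (n : nat)
    (f : 'cV[R]_n -> \bar R) : Prop :=
  [/\ proper_ext f, closed (epigraph f)
    & convex_set (epigraph f : set (convex_lmodType ('cV[R]_n * R^o)%type))].

Definition indicator (R : realType) (n : nat) (S : set 'cV[R]_n)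
    (z : 'cV[R]_n) : \bar R :=
  if z \in S then 0%E else +oo%E.

(* [sup_{z in Z} <y, z> - h z], the conjugate of [h + indicator Z]. *)
Definition conjugate_on (R : realType) (n : nat) (Z : set 'cV[R]_n)
    (h : 'cV[R]_n -> \bar R) (y : 'cV[R]_n) : \bar R :=
  ereal_sup [set ((dot y z)%:E - h z)%E | z in Z].

Definition argmin (R : realType) (T : Type) (S : set T) (F : T -> \bar R) : set T :=
  [set x | S x /\ forall x', S x' -> (F x <= F x')%E].

Definition grad (R : realType) (n : nat) (f : 'cV[R]_n -> R) (x : 'cV[R]_n) :
    'cV[R]_n :=
  \col_j 'D_(delta_mx j ord0) f x.

Definition smooth_convex (R : realType) (n : nat) (f : 'cV[R]_n -> R) : Prop :=
  [/\ forall x, differentiable f x,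
      exists L : R, forall x x',
        sqnorm (grad f x - grad f x') <= L * sqnorm (x - x')
    & convex_function [set: convex_lmodType 'cV[R]_n] f].

(* At every iteration, whatever the selections made before, [S k] is uniformly
   distributed on [E]; equivalently, every finite trajectory in [E] of length
   [l] has probability [#|E| ^ -l]. *)
Definition uniform_selection (R : realType) (d : measure_display)
    (Omega : measurableType d) (Pr : probability Omega R)
    (T : finType) (E : {set T}) (S : nat -> Omega -> T) : Prop :=
  [/\ forall k w, S k w \in E,
      forall k t, measurable [set w | S k w = t]
    & forall (l : nat) (s : nat -> T), (forall k, s k \in E) ->
        Pr [set w | forall k, (k < l)%N -> S k w = s k]
        = ((#|E|%:R : R) ^- l)%:E].

Section BlockVectors.
Context (R : realType) (N p : nat) (m : 'I_N -> nat).
Implicit Types (x : 'cV[R]_(\sum_i m i)) (I : {set 'I_N}).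

(* The sub-vector [x_I] and the sub-matrix [A_I], the blocks of [I] being
   listed as [enum_val j] for [j < #|I|]. *)
Definition subvec I x : 'cV[R]_(\sum_(j < #|I|) m (enum_val j)) :=
  \mxcol_(j < #|I|) submxcol x (enum_val j).

Definition submat I (A : forall i, 'M[R]_(p, m i)) :
    'M[R]_(p, \sum_(j < #|I|) m (enum_val j)) :=
  \mxrow_(j < #|I|) A (enum_val j).

End BlockVectors.

Definition primal_dual_updates (R : realType) (N p : nat) (m : 'I_N -> nat)
    (A : forall i, 'M[R]_(p, m i)) (X : forall i, set 'cV[R]_(m i))
    (u : forall i, 'cV[R]_(m i) -> \bar R)
    (Z : set 'cV[R]_p) (h : 'cV[R]_p -> \bar R) (tau eta q : R)
    (i : nat -> 'I_N) (x : nat -> 'cV[R]_(\sum_i m i))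
    (z zbar : nat -> 'cV[R]_p) : Prop :=
  forall k : nat,
  [/\ argmin (X (i k))
        (fun xi => ((dot (- zbar k) (A (i k) *m xi))%:E + u (i k) xi
           + (tau / 2 * sqnorm (xi - submxcol (x k) (i k)))%:E)%E)
        (submxcol (x k.+1) (i k)),
      forall j, j <> i k -> submxcol (x k.+1) j = submxcol (x k) j,
      argmin Z
        (fun zeta => (h zeta + (dot zeta (\mxrow_i A i *m x k.+1))%:E
           + (eta / 2 * sqnorm (zeta - z k))%:E)%E)
        (z k.+1)
    & zbar k.+1 = q *: (z k.+1 - z k) + z k.+1].

Definition split_updates (R : realType) (N p : nat) (m : 'I_N -> nat)
    (A : forall i, 'M[R]_(p, m i)) (X : forall i, set 'cV[R]_(m i))
    (u : forall i, 'cV[R]_(m i) -> \bar R)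
    (Z : set 'cV[R]_p) (h : 'cV[R]_p -> \bar R) (tau eta q : R)
    (i : nat -> 'I_N) (x : nat -> 'cV[R]_(\sum_i m i))
    (y z : nat -> 'cV[R]_p) : Prop :=
  let r k := \mxrow_i A i *m x k + y k in
  forall k : nat,
  [/\ argmin (X (i k))
        (fun xi => ((dot (- z k) (A (i k) *m xi))%:E + u (i k) xi
           + (q / (2 * eta)
                * sqnorm (A (i k) *m (xi - submxcol (x k) (i k)) + r k))%:E
           + (1 / 2 * wsqnorm (tau%:M - (q / eta) *: ((A (i k))^T *m A (i k)))
                        (xi - submxcol (x k) (i k)))%:E)%E)
        (submxcol (x k.+1) (i k)),
      forall j, j <> i k -> submxcol (x k.+1) j = submxcol (x k) j,
      argmin setT
        (fun ups => (conjugate_on Z h ups - (dot ups (z k))%:E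
           + (1 / (2 * eta) * sqnorm (ups + \mxrow_i A i *m x k.+1))%:E)%E)
        (y k.+1)
    & z k.+1 = z k - (1 / eta) *: (\mxrow_i A i *m x k.+1 + y k.+1)].

(* Data of the problem
     min f(x) + sum_i u_i(x_i) + g0(y) + v(y)
     s.t. A x + B y = b, x in prod_i X_i, y in Y. *)
Record two_block_problem (R : realType) (N p l : nat) (m : 'I_N -> nat) :=
  TwoBlockProblem {
    tb_f : 'cV[R]_(\sum_i m i) -> R;
    tb_u : forall i, 'cV[R]_(m i) -> \bar R;
    tb_X : forall i, set 'cV[R]_(m i);
    tb_A : forall i, 'M[R]_(p, m i);
    tb_g0 : 'cV[R]_l -> R;
    tb_v : 'cV[R]_l -> \bar R;
    tb_Y : set 'cV[R]_l;
    tb_B : 'M[R]_(p, l);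
    tb_b : 'cV[R]_p }.
Arguments tb_u {R N p l m} _ i _.
Arguments tb_X {R N p l m} _ i _.

Section RPDBU.
Context (R : realType) (N p l : nat) (m : 'I_N -> nat).
Context (pb : two_block_problem R p l m).

Definition admissible : Prop :=
  [/\ smooth_convex (tb_f pb), smooth_convex (tb_g0 pb),
      (forall i, proper_closed_convex (tb_u pb i)),
      proper_closed_convex (tb_v pb)
    & (forall i, closed_convex_set (tb_X pb i))
      /\ closed_convex_set (tb_Y pb)].

(* [rhalf k] stands for r^{k+1/2}. *)
Definition rpdbu_updates (rho_x rho_y rho : R) (I : nat -> {set 'I_N})
    (P : forall k, 'M[R]_(\sum_(j < #|I k|) m (enum_val j)))
    (Q : nat -> 'M[R]_l)
    (x : nat -> 'cV[R]_(\sum_i m i)) (y : nat -> 'cV[R]_l)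
    (lambda r rhalf : nat -> 'cV[R]_p) : Prop :=
  let A k := submat (I k) (tb_A pb) in
  let B := tb_B pb in
  r 0%N = \mxrow_i tb_A pb i *m x 0%N + B *m y 0%N - tb_b pb /\
  forall k : nat,
  [/\ (P k)^T = P k /\ (Q k)^T = Q k,
      (forall i, i \notin I k -> submxcol (x k.+1) i = submxcol (x k) i),
      argmin
        [set xI | forall j : 'I_#|I k|, tb_X pb (enum_val j) (submxcol xI j)]
        (fun xI =>
          ((dot (subvec (I k) (grad (tb_f pb) (x k)) - (A k)^T *m lambda k) xI)%:E
           + \sum_(j < #|I k|) tb_u pb (enum_val j) (submxcol xI j)
           + (rho_x / 2 * sqnorm (A k *m (xI - subvec (I k) (x k)) + r k))%:E
           + (1 / 2 * wsqnorm (P k) (xI - subvec (I k) (x k)))%:E)%E)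
        (subvec (I k) (x k.+1)),
      rhalf k = r k + A k *m (subvec (I k) (x k.+1) - subvec (I k) (x k))
    & [/\ argmin (tb_Y pb)
            (fun ups =>
              ((dot (grad (tb_g0 pb) (y k) - B^T *m lambda k) ups)%:E
               + tb_v pb ups
               + (rho_y / 2 * sqnorm (B *m (ups - y k) + rhalf k))%:E
               + (1 / 2 * wsqnorm (Q k) (ups - y k))%:E)%E)
            (y k.+1),
          r k.+1 = rhalf k + B *m (y k.+1 - y k)
        & lambda k.+1 = lambda k - rho *: r k.+1]].

End RPDBU.

(* Runs of the methods: the iterates are functions of the outcome [w], the
   starting points are deterministic. *)
Section Runs.
Context (R : realType) (d : measure_display) (Omega : measurableType d).
Context (Pr : probability Omega R) (N p : nat) (m : 'I_N -> nat).

Definition primal_dual_run (A : forall i, 'M[R]_(p, m i))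
    (X : forall i, set 'cV[R]_(m i)) (u : forall i, 'cV[R]_(m i) -> \bar R)
    (Z : set 'cV[R]_p) (h : 'cV[R]_p -> \bar R) (tau eta q : R)
    (x0 : 'cV[R]_(\sum_i m i)) (z0 zbar0 : 'cV[R]_p) (i : nat -> Omega -> 'I_N)
    (x : nat -> Omega -> 'cV[R]_(\sum_i m i)) (z zbar : nat -> Omega -> 'cV[R]_p) :
    Prop :=
  uniform_selection Pr [set: 'I_N]%SET i /\
  forall w, [/\ x 0%N w = x0, z 0%N w = z0, zbar 0%N w = zbar0
    & primal_dual_updates A X u Z h tau eta q (i^~ w) (x^~ w) (z^~ w) (zbar^~ w)].

Definition split_run (A : forall i, 'M[R]_(p, m i))
    (X : forall i, set 'cV[R]_(m i)) (u : forall i, 'cV[R]_(m i) -> \bar R)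
    (Z : set 'cV[R]_p) (h : 'cV[R]_p -> \bar R) (tau eta q : R)
    (x0 : 'cV[R]_(\sum_i m i)) (y0 z0 : 'cV[R]_p) (i : nat -> Omega -> 'I_N)
    (x : nat -> Omega -> 'cV[R]_(\sum_i m i)) (y z : nat -> Omega -> 'cV[R]_p) :
    Prop :=
  uniform_selection Pr [set: 'I_N]%SET i /\
  forall w, [/\ x 0%N w = x0, y 0%N w = y0, z 0%N w = z0
    & split_updates A X u Z h tau eta q (i^~ w) (x^~ w) (y^~ w) (z^~ w)].

Definition rpdbu_run (l : nat) (pb : two_block_problem R p l m) (n : nat)
    (rho_x rho_y rho : R) (I : nat -> Omega -> {set 'I_N})
    (P : forall k w, 'M[R]_(\sum_(j < #|I k w|) m (enum_val j)))
    (Q : nat -> Omega -> 'M[R]_l)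
    (x0 : 'cV[R]_(\sum_i m i)) (y0 : 'cV[R]_l) (lambda0 : 'cV[R]_p)
    (x : nat -> Omega -> 'cV[R]_(\sum_i m i)) (y : nat -> Omega -> 'cV[R]_l)
    (lambda r rhalf : nat -> Omega -> 'cV[R]_p) : Prop :=
  uniform_selection Pr [set J : {set 'I_N} | #|J| == n]%SET I /\
  forall w, [/\ x 0%N w = x0, y 0%N w = y0, lambda 0%N w = lambda0
    & rpdbu_updates pb rho_x rho_y rho (I := I^~ w) (P^~ w) (Q^~ w)
        (x^~ w) (y^~ w) (lambda^~ w) (r^~ w) (rhalf^~ w)].

End Runs.

(* Main.v *)
Require Import Defs.
From HB Require Import structures.
From mathcomp Require Import all_boot all_order all_algebra.
From mathcomp Require Import all_classical all_reals all_analysis.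
From mathcomp Require Import ring lra.

Set Implicit Arguments.
Unset Strict Implicit.
Unset Printing Implicit Defensive.

Import Order.TTheory GRing.Theory Num.Theory.
Import numFieldNormedType.Exports.

Local Open Scope classical_set_scope.
Local Open Scope ring_scope.

(** The point [y] that minimizes the [y]-subproblem and the point [z] that
    minimizes the [z]-subproblem are linked by [z = z^k - (A x + y) / eta]: with
    this relation, either optimality condition says that [y] is a subgradient of
    [h + indicator Z] at [z].  Optimality of [z] gives optimality of [y] directly;
    the converse follows because the [z]-subproblem has a minimizer, which
    produces a minimizer of the strongly convex [y]-subproblem, hence the only
    one.  By induction [zbar^k = z^k - (q / eta) r^k], and then the two
    [x]-subproblems have objectives that differ by a constant. *)

(** * Euclidean inner product and squared norm *)

Section Dot.
Context {R : realType}.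
Implicit Types (n : nat) (a : R).

Lemma dotE n (v w : 'cV[R]_n) : dot v w = \sum_j v j ord0 * w j ord0.
Proof. by rewrite /dot mxE; apply: eq_bigr => j _; rewrite mxE. Qed.

Lemma dotC n (v w : 'cV[R]_n) : dot v w = dot w v.
Proof. by rewrite !dotE; apply: eq_bigr => j _; rewrite mulrC. Qed.

Lemma dotDr n (v w1 w2 : 'cV[R]_n) : dot v (w1 + w2) = dot v w1 + dot v w2.
Proof. by rewrite /dot mulmxDr mxE. Qed.

Lemma dotZr n a (v w : 'cV[R]_n) : dot v (a *: w) = a * dot v w.
Proof. by rewrite /dot -scalemxAr mxE. Qed.

Lemma dotNr n (v w : 'cV[R]_n) : dot v (- w) = - dot v w.
Proof. by rewrite -scaleN1r dotZr mulN1r. Qed.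

Lemma dotBr n (v w1 w2 : 'cV[R]_n) : dot v (w1 - w2) = dot v w1 - dot v w2.
Proof. by rewrite dotDr dotNr. Qed.

Lemma dot0r n (v : 'cV[R]_n) : dot v 0 = 0.
Proof. by rewrite -(scale0r v) dotZr mul0r. Qed.

Lemma dotDl n (v1 v2 w : 'cV[R]_n) : dot (v1 + v2) w = dot v1 w + dot v2 w.
Proof. by rewrite !(dotC _ w) dotDr. Qed.

Lemma dotZl n a (v w : 'cV[R]_n) : dot (a *: v) w = a * dot v w.
Proof. by rewrite !(dotC _ w) dotZr. Qed.

Lemma dotNl n (v w : 'cV[R]_n) : dot (- v) w = - dot v w.
Proof. by rewrite !(dotC _ w) dotNr. Qed.

Lemma dotBl n (v1 v2 w : 'cV[R]_n) : dot (v1 - v2) w = dot v1 w - dot v2 w.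
Proof. by rewrite dotDl dotNl. Qed.

Lemma dot0l n (w : 'cV[R]_n) : dot 0 w = 0.
Proof. by rewrite dotC dot0r. Qed.

Definition dot_linE :=
  (@dotDl, @dotDr, @dotNl, @dotNr, @dotZl, @dotZr, @dot0l, @dot0r).

Lemma dot_trmx_mul n n' (M : 'M[R]_(n, n')) (v : 'cV[R]_n) (w : 'cV[R]_n') :
  dot (M^T *m v) w = dot v (M *m w).
Proof. by rewrite /dot trmx_mul trmxK mulmxA. Qed.

Lemma sqnorm_ge0 n (v : 'cV[R]_n) : 0 <= sqnorm v.
Proof.
by rewrite /sqnorm dotE; apply: sumr_ge0 => j _; rewrite -expr2 sqr_ge0.
Qed.

Lemma sqr_coord_le_sqnorm n (v : 'cV[R]_n) j : v j ord0 ^+ 2 <= sqnorm v.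
Proof.
rewrite /sqnorm dotE (bigD1 j)//= -expr2 lerDl.
by apply: sumr_ge0 => k _; rewrite -expr2 sqr_ge0.
Qed.

Lemma sqnorm_le0 n (v : 'cV[R]_n) : sqnorm v <= 0 -> v = 0.
Proof.
move=> v0; apply/matrixP => j k; rewrite ord1 mxE; apply/eqP.
rewrite -sqrf_eq0 eq_le sqr_ge0 andbT.
exact: le_trans (sqr_coord_le_sqnorm v j) v0.
Qed.

Lemma sqnormD n (v w : 'cV[R]_n) :
  sqnorm (v + w) = sqnorm v + 2 * dot v w + sqnorm w.
Proof. by rewrite /sqnorm !dot_linE (dotC w v); ring. Qed.

Lemma sqnormZ n a (v : 'cV[R]_n) : sqnorm (a *: v) = a ^+ 2 * sqnorm v.
Proof. by rewrite /sqnorm !dot_linE; ring. Qed.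

Lemma sqnorm0 n : sqnorm (0 : 'cV[R]_n) = 0.
Proof. by rewrite /sqnorm dot0r. Qed.

Lemma sqnormN n (v : 'cV[R]_n) : sqnorm (- v) = sqnorm v.
Proof. by rewrite /sqnorm !dot_linE opprK. Qed.

Lemma wsqnorm_scalarB n n' (M : 'M[R]_(n, n')) (a c : R) (v : 'cV[R]_n') :
  wsqnorm (a%:M - c *: (M^T *m M)) v = a * sqnorm v - c * sqnorm (M *m v).
Proof.
rewrite /wsqnorm -mulmxA mulmxBl -[_ ord0 ord0]/(dot v _) dotBr.
rewrite mul_scalar_mx dotZr -scalemxAl dotZr; congr (_ - _ * _).
by rewrite -mulmxA dotC dot_trmx_mul.
Qed.

Lemma wsqnorm0 n (v : 'cV[R]_n) : wsqnorm 0 v = 0.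
Proof. by rewrite /wsqnorm mulmx0 mul0mx mxE. Qed.

Lemma continuous_dotl n (a : 'cV[R]_n) : continuous (fun v => dot v a).
Proof.
move=> v; have -> : (fun v => dot v a) = fun w => \sum_j w j ord0 * a j ord0.
  by apply/funext => w; rewrite dotE.
apply: (@cvg_big R _ +%R 0 _ add_continuous _ (nbhs v)) => j _.
by apply: cvgM; [exact: coord_continuous|exact: cvg_cst].
Qed.

Lemma continuous_sqnorm n : continuous (@sqnorm R n).
Proof.
move=> v; have -> : @sqnorm R n = fun w => \sum_j w j ord0 * w j ord0.
  by apply/funext => w; rewrite /sqnorm dotE.
apply: (@cvg_big R _ +%R 0 _ add_continuous _ (nbhs v)) => j _.
by apply: cvgM; exact: coord_continuous.
Qed.

End Dot.

(** Replaces interval-typed weights by a number [s] between 0 and 1. *)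
Lemma convex_set_lmodP (R : numDomainType) (V : lmodType R) (S : set V) :
  convex_set (S : set (convex_lmodType V)) <->
  (forall (s : R) x y, 0 <= s -> s <= 1 -> S x -> S y ->
     S (s *: x + (1 - s) *: y)).
Proof.
split=> [cS s x y s0 s1 Sx Sy|cS x y s].
  by have := cS x y (Itv01 s0 s1); rewrite !inE => /(_ Sx Sy).
by rewrite !inE => Sx Sy; apply: cS.
Qed.

(** * Existence of minimizers on closed sets, and first-order conditions *)

Section MinimizationOnClosedSets.
Context {R : realType} {n : nat}.
Implicit Types (E : set ('cV[R]_n * R^o)) (v w : 'cV[R]_n).

Lemma continuous_trmx m m' : continuous (@trmx R m m').
Proof.
move=> M U [P nP sP]; exists (fun j k => P k j) => [j k|L LP].
  by have := nP k j; rewrite mxE.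
by apply: sP => j k; rewrite mxE; exact: LP.
Qed.

Lemma compact_col_box (M : R) :
  compact [set v : 'cV[R]_n | forall j, `|v j ord0| <= M].
Proof.
have -> : [set v : 'cV[R]_n | forall j, `|v j ord0| <= M] =
    trmx @` [set v : 'rV[R]_n | forall j, `[(- M), M]%classic (v ord0 j)].
  apply/seteqP; split => [v vM|_ [v vM <-] j].
    exists v^T; rewrite ?trmxK// => j.
    by rewrite mxE /= in_itv/= -ler_norml; exact: vM.
  by have := vM j; rewrite mxE /= in_itv/= -ler_norml.
have cR := @rV_compact _ n (fun=> `[(- M), M]%classic)
  (fun=> @segment_compact _ (- M) M).
apply: (continuous_compact _ cR).
by apply: continuous_subspaceT; exact: continuous_trmx.
Qed.

(** Weierstrass on the part of [E] where [phi] is at most [phi e0], which the last hypothesis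
    encloses in a compact box; elsewhere [phi] exceeds [phi e0]. *)
Lemma closed_coercive_min E (phi : 'cV[R]_n * R^o -> R) e0 (M : R) :
  closed E -> continuous phi -> E e0 ->
  (forall e, E e -> phi e <= phi e0 ->
     (forall j, `|e.1 j ord0| <= M) /\ `|e.2 : R| <= M) ->
  exists2 c, E c & forall e, E e -> phi c <= phi e.
Proof.
move=> clE cphi Ee0 bndE.
pose K := E `&` [set e | phi e <= phi e0].
have cK : compact K.
  have cB := compact_setX (@compact_col_box M) (@segment_compact _ (- M) M).
  apply: (subclosed_compact (A := K) _ cB).
    apply: closedI => //.
    exact: (closed_comp (fun e _ => cphi e) (closed_le (y := phi e0))).
  move=> e [Ee /(bndE _ Ee)[e1 e2]]; split => //=.
  by rewrite in_itv/= -ler_norml.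
have [||c] := compact_EVT_min (A := K) (f := phi) _ cK.
- by exists e0; split => /=.
- exact: continuous_subspaceT.
rewrite inE => -[Ec _] minc; exists c => // e Ee.
have [le_e|/ltW lt_e] := lerP (phi e) (phi e0); first by apply: minc; rewrite inE.
by apply: le_trans lt_e; apply: minc; rewrite inE; split=> /=.
Qed.

Lemma norm_le_sqr (a : R) : `|a| <= 1 + a ^+ 2.
Proof. by rewrite ler_norml; apply/andP; split; nra. Qed.

Lemma norm_coord_le v j : `|v j ord0| <= 1 + sqnorm v.
Proof.
by apply: le_trans (norm_le_sqr _) _; rewrite lerD2l sqr_coord_le_sqnorm.
Qed.

(** Crude Cauchy-Schwarz bound without square roots, from expanding the squares of [v + w] and
    [v - w]. *)
Lemma norm_dot_le v w : `|dot v w| <= sqnorm v + sqnorm w.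
Proof.
have := sqnorm_ge0 (v + w); have := sqnorm_ge0 (v - w).
rewrite !sqnormD sqnormN dotNr => h1 h2.
have := sqnorm_ge0 v; have := sqnorm_ge0 w => h3 h4.
by rewrite ler_norml; apply/andP; split; lra.
Qed.

(** Division by [s] followed by [s] tending to 0; this turns minimality along segments into
    variational inequalities. *)
Lemma first_order_ge0 (a b : R) :
  (forall s, 0 < s -> s <= 1 -> 0 <= s * a + s ^+ 2 * b) -> 0 <= a.
Proof.
move=> H; rewrite leNgt; apply/negP => a0.
have d0 : 0 < - a + `|b| by have := normr_ge0 b; lra.
(* With this [s], the product of [s] and the absolute value of [b] is at most [- a / 2], so
   [a + s * b] is negative. *)
pose s := - a / (2 * (- a + `|b|)).
have sd : s * (2 * (- a + `|b|)) = - a by rewrite /s mulfVK// gt_eqF// mulr_gt0.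
have s0 : 0 < s by rewrite /s divr_gt0 ?oppr_gt0// mulr_gt0.
have hb := normr_ge0 b; have hb2 := ler_norm b.
have s1 : s <= 1 by nra.
have := H s s0 s1; have : s * b <= s * `|b| by rewrite ler_pM2l.
by nra.
Qed.

End MinimizationOnClosedSets.

(** * Affine minorants and quadratic minimization for closed convex sets of points with heights *)

Section AffineMinorant.
Context {R : realType} {n : nat} (E : set ('cV[R]_n * R^o)).
Hypotheses (clE : closed E)
  (cvxE : convex_set (E : set (convex_lmodType ('cV[R]_n * R^o)%type))).

(* The projection of a point lying strictly below [E] onto [E] yields a
   separating hyperplane; it is not vertical because [E] meets the vertical
   line through that point. *)
Lemma convex_affine_minorant (z : 'cV[R]_n) (t : R) :
  E (z, t) -> ~ E (z, t - 1) ->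
  exists (a : 'cV[R]_n) (b : R), forall e, E e -> b + dot a e.1 <= e.2.
Proof.
move=> Ezt nEzt; pose phi (e : 'cV[R]_n * R^o) : R :=
  sqnorm (e.1 - z) + (e.2 - (t - 1)) ^+ 2.
have cphi : continuous phi.
  have c1 : continuous (fun e : 'cV[R]_n * R^o => e.1 - z).
    by move=> e; apply: cvgB; [exact: cvg_fst|exact: cvg_cst].
  have c2 : continuous (fun e : 'cV[R]_n * R^o => e.2 - (t - 1) : R).
    by move=> e; apply: cvgB; [exact: cvg_snd|exact: cvg_cst].
  move=> e; apply: cvgD.
    exact: (continuous_comp (c1 e) (@continuous_sqnorm R n _)).
  exact: (continuous_comp (c2 e) (@exprn_continuous _ 2 _)).
have phi0 : phi (z, t) = 1 by rewrite /phi /= subrr sqnorm0; ring.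
(* Where [phi] is at most 1, every coordinate is within 2 of that of [(z, t - 1)]; this fixes the
   size of the box. *)
have [|[zc tc] Ec minc] :=
    closed_coercive_min (M := 3 + sqnorm z + `|t - 1|) clE cphi Ezt.
  move=> [w s] _; rewrite phi0 /phi /= => le1.
  have sw := sqnorm_ge0 (w - z); have ss := sqr_ge0 (s - (t - 1)).
  have n1 := normr_ge0 (t - 1); have n2 := sqnorm_ge0 z; split.
    move=> j; have /(le_trans (ler_normD _ _)) :
        `|(w - z) j ord0| + `|z j ord0| <= 2 + (1 + sqnorm z).
      apply: lerD; last exact: norm_coord_le.
      by apply: le_trans (norm_coord_le _ _) _; lra.
    by rewrite !mxE subrK; lra.
  have := ler_normD (s - (t - 1)) (t - 1); rewrite subrK.
  by have := norm_le_sqr (s - (t - 1)); lra.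
pose b := tc - (t - 1).
(* Variational inequality of the projection [(zc, tc)], from moving toward [e] along the segment. *)
have var e : E e -> 0 <= dot (zc - z) (e.1 - zc) + b * (e.2 - tc).
  move=> Ee; rewrite -(pmulr_rge0 _ (ltr0n R 2)).
  apply: (first_order_ge0 (b := sqnorm (e.1 - zc) + (e.2 - tc) ^+ 2)) => s s0 s1.
  have := (convex_set_lmodP _).1 cvxE s e (zc, tc) (ltW s0) s1 Ee Ec.
  move/minc; rewrite /phi /=.
  have -> : s *: e.1 + (1 - s) *: zc - z = (zc - z) + s *: (e.1 - zc).
    by apply/matrixP => j k; rewrite !mxE; ring.
  have -> : s *: e.2 + (1 - s) *: tc = s * e.2 + (1 - s) * tc by [].
  rewrite [sqnorm (_ + s *: _)]sqnormD dotZr sqnormZ /b -subr_ge0.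
  by move/le_trans; apply; rewrite le_eqVlt; apply/orP; left; apply/eqP; ring.
(* Testing [var] at [(z, t)] gives [sqnorm (zc - z) <= b * (1 - b)], so [b] is nonnegative; [b = 0]
   would make [(z, t - 1)] its own projection, hence a point of [E]. *)
have b0 : 0 < b.
  have := var _ Ezt; rewrite /= -[z - zc]opprB dotNr -/(sqnorm _).
  have := sqnorm_ge0 (zc - z).
  have -> : t - tc = 1 - b by rewrite /b; ring.
  move=> s0 hb; have [//|bn] := ltrP 0 b.
  have b1 : b = 0 by nra.
  exfalso; apply: nEzt; rewrite b1 in hb.
  have /eqP : zc - z = 0 by apply: sqnorm_le0; lra.
  rewrite subr_eq0 => /eqP <-.
  have -> : t - 1 = tc by rewrite -[tc](subrK (t - 1)) -/b b1 add0r.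
  by [].
exists (- b^-1 *: (zc - z)), (tc + b^-1 * dot (zc - z) zc) => e /var.
rewrite dotZl dotBr => H; rewrite -(ler_pM2l b0).
rewrite -subr_ge0; move: H; congr (0 <= _); field; exact: lt0r_neq0.
Qed.

(** Keeping the height as a variable makes the objective continuous; the affine minorant together
    with the quadratic term makes it coercive. *)
Lemma convex_quadratic_min (z a : 'cV[R]_n) (t eta : R) :
  0 < eta -> E (z, t) -> ~ E (z, t - 1) ->
  exists2 c, E c & forall e, E e ->
    (c.2 : R) + dot c.1 a + eta / 2 * sqnorm c.1
      <= (e.2 : R) + dot e.1 a + eta / 2 * sqnorm e.1.
Proof.
move=> eta0 Ezt nEzt; have [b [c minor]] := convex_affine_minorant Ezt nEzt.
pose phi (e : 'cV[R]_n * R^o) : R :=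
  (e.2 : R) + dot e.1 a + eta / 2 * sqnorm e.1.
have cphi : continuous phi.
  move=> e; apply: cvgD; first apply: cvgD; first exact: cvg_snd.
    exact: (continuous_comp cvg_fst (@continuous_dotl R n a _)).
  apply: cvgM; first exact: cvg_cst.
  exact: (continuous_comp cvg_fst (@continuous_sqnorm R n _)).
pose K := phi (z, t).
(* Bound on [sqnorm w] over the sublevel set: the minorant [c + dot b w] bounds the height from
   below, and completing the square absorbs [dot (a + b) w] into half of the quadratic term. *)
pose D := 4 / eta * (K - c + sqnorm (a + b) / eta).
apply: (closed_coercive_min (phi := phi) (M := 1 + `|D| + sqnorm a + sqnorm b
  + `|K| + `|c| + `|eta / 2 * D|) clE cphi Ezt).
move=> [w s] /minor /= le_s; rewrite -/K /phi /= => le_K.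
have a0 := sqnorm_ge0 a; have b0 := sqnorm_ge0 b; have w0 := sqnorm_ge0 w.
have [nD nK nc nE] :=
  And4 (normr_ge0 D) (normr_ge0 K) (normr_ge0 c) (normr_ge0 (eta / 2 * D)).
have wD : sqnorm w <= D.
  have := sqnorm_ge0 ((a + b) + (eta / 2) *: w).
  rewrite sqnormD sqnormZ dotZr dotDl (dotC a w) => H.
  have H2 : c + dot b w + dot w a + eta / 2 * sqnorm w <= K by lra.
  have e4 : 0 < eta / 4 by rewrite divr_gt0.
  rewrite /D -(ler_pM2l e4).
  have -> : eta / 4 * (4 / eta * (K - c + sqnorm (a + b) / eta)) =
     K - c + sqnorm (a + b) / eta by field; exact: lt0r_neq0.
  rewrite -(ler_pM2l eta0).
  have -> : eta * (K - c + sqnorm (a + b) / eta) = eta * K - eta * c + sqnorm (a + b).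
    by field; exact: lt0r_neq0.
  by have := ler_wpM2l (ltW eta0) H2; lra.
have DD := ler_norm D; have KK := ler_norm K.
have cc : - `|c| <= c by rewrite lerNl -normrN ler_norm.
have EE : eta / 2 * sqnorm w <= `|eta / 2 * D|.
  by apply: le_trans (ler_norm _); rewrite ler_pM2l// divr_gt0.
have E0 : 0 <= eta / 2 * sqnorm w by rewrite mulr_ge0// divr_ge0// ltW.
split=> [j|]; first by have := norm_coord_le w j; lra.
have := norm_dot_le w a; have := norm_dot_le b w.
rewrite !ler_norml => /andP[h1 h2] /andP[h3 h4].
by apply/andP; split; lra.
Qed.

End AffineMinorant.

(** * Moreau duality for [h] on [Z] and its conjugate *)

Section MoreauDuality.
Context {R : realType} {p : nat} (Z : set 'cV[R]_p) (h : 'cV[R]_p -> \bar R).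
Hypotheses (hZ : closed_convex_set Z) (hh : proper_closed_convex h)
  (hhZ : proper_ext (fun z => h z + indicator Z z)%E).
Let g := conjugate_on Z h.

(** Points where [h] is [+oo] contribute [-oo] to the supremum and properness excludes the value
    [-oo], so only real inequalities remain. *)
Lemma conjugate_on_leP y (t : R) :
  (g y <= t%:E)%E <->
  (forall z s, Z z -> h z = s%:E -> dot y z - s <= t).
Proof.
split=> [gt z s Zz hs|H].
  rewrite -lee_fin (le_trans _ gt)//.
  by apply: ereal_sup_ubound; exists z => //; rewrite hs EFinB.
apply: ge_ereal_sup => _ [z Zz <-].
case hz : (h z) => [s| |]; last 2 first.
- by rewrite /= leNye.
- by case: hh => -[/(_ z)].
by rewrite -EFinB lee_fin; exact: H hz.
Qed.

Lemma conjugate_on_ge y z s :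
  Z z -> h z = s%:E -> ((dot y z - s)%:E <= g y)%E.
Proof. by move=> Zz hs; apply: ereal_sup_ubound; exists z => //; rewrite hs EFinB. Qed.

Lemma domain_nonempty : exists z s, Z z /\ h z = s%:E.
Proof.
case: hhZ => _ [z]; rewrite /indicator; case: ifPn => [Zz|_].
  rewrite adde0; case hz : (h z) => [s| |] // _; last by case: hh => -[/(_ z)].
  by exists z, s; split => //; move: Zz; rewrite inE.
by case hz : (h z) => [s| |] // _; case: hh => -[/(_ z)].
Qed.

(** The epigraph of [h + indicator Z], in a form where closedness and convexity are inherited from
    [h] and [Z]. *)
Let E : set ('cV[R]_p * R^o) := epigraph h `&` (Z `*` setT).

Lemma closed_epigraph_on : closed E.
Proof.
apply: closedI; first by case: hh.
have -> : Z `*` setT = (@fst 'cV[R]_p R^o) @^-1` Z.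
  by apply/seteqP; split => [e []|e Ze].
by apply: closed_comp; [move=> ? _; exact: cvg_fst|case: hZ].
Qed.

Lemma convex_epigraph_on :
  convex_set (E : set (convex_lmodType ('cV[R]_p * R^o)%type)).
Proof.
apply/convex_set_lmodP => s x y s0 s1 [hx [Zx _]] [hy [Zy _]]; split.
  by case: hh => _ _ /convex_set_lmodP; apply.
by split => //=; case: hZ => _ /convex_set_lmodP; apply.
Qed.

Section Prox.
Context (a w : 'cV[R]_p) (eta : R).
Hypothesis eta_gt0 : 0 < eta.
(** [F] and [G] are the objectives of the z- and y-subproblems, with [a] for A x^{k+1} and [w] for
    z^k. *)
Let F zeta := (h zeta + (dot zeta a)%:E + (eta / 2 * sqnorm (zeta - w))%:E)%E.
Let G ups :=
  (g ups - (dot ups w)%:E + (1 / (2 * eta) * sqnorm (ups + a))%:E)%E.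

Lemma prox_exists : exists z, argmin Z F z.
Proof.
have [z0 [t0 [Zz0 hz0]]] := domain_nonempty.
(* [a - eta *: w] is the linear coefficient left when the square in [F] is expanded; [t0] is the
   lowest height over [z0], so [(z0, t0 - 1)] lies outside [E]. *)
have [||[z t] [/= hzt [/= Zz _]] minz] := @convex_quadratic_min R p E
  closed_epigraph_on convex_epigraph_on z0 (a - eta *: w) t0 eta eta_gt0.
- by split => //; rewrite /epigraph /= hz0.
- by rewrite /E/epigraph /= hz0 lee_fin => -[/= + _]; lra.
exists z; split => // z' Zz'; rewrite /F.
case hz' : (h z') => [t'| |]; last 2 first.
- by rewrite leey.
- by case: hh => -[/(_ z')].
apply: (@le_trans _ _ (t%:E + (dot z a)%:E + (eta / 2 * sqnorm (z - w))%:E)%E).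
  by rewrite !leeD2r.
rewrite -!EFinD lee_fin.
have /minz /= : E (z', t') by split => //; rewrite /epigraph /= hz'.
rewrite ![sqnorm (_ - w)]sqnormD sqnormN !dotBr !dotNr !dotZr.
lra.
Qed.

(** [F] at [z] is compared with [F] on the segment toward [z'], where convexity bounds [h]. The
    first-order terms say that [eta *: (w - z) - a] is a subgradient of [h + indicator Z] at [z]. *)
Lemma prox_subgradient z : argmin Z F z ->
  exists2 t, h z = t%:E & forall z' t', Z z' -> h z' = t'%:E ->
    t + dot (eta *: (w - z) - a) (z' - z) <= t'.
Proof.
move=> [Zz minz]; have [z0 [t0 [Zz0 hz0]]] := domain_nonempty.
case hz : (h z) => [t| |]; last 2 first.
- by have := minz _ Zz0; rewrite /F hz hz0.
- by case: hh => -[/(_ z)].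
exists t => // z' t' Zz' hz'; rewrite -subr_ge0.
apply: (first_order_ge0 (b := eta / 2 * sqnorm (z' - z))) => s s0 s1.
have [/= hs [/= Zs _]] :
    E (s *: z' + (1 - s) *: z, s *: (t' : R^o) + (1 - s) *: (t : R^o)).
  apply: ((convex_set_lmodP _).1 convex_epigraph_on s (z', t') (z, t)) => //.
  - exact: ltW.
  - by split => //; rewrite /epigraph /= hz'.
  - by split => //; rewrite /epigraph /= hz.
have := minz _ Zs; rewrite /F hz.
move/le_trans => /(_ ((s * t' + (1 - s) * t)%:E +
   (dot (s *: z' + (1 - s) *: z) a)%:E +
   (eta / 2 * sqnorm (s *: z' + (1 - s) *: z - w))%:E)%E).
rewrite !leeD2r// => /(_ erefl); rewrite -!EFinD lee_fin.
have -> : s *: z' + (1 - s) *: z = z + s *: (z' - z).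
  by apply/matrixP => j k; rewrite !mxE; ring.
rewrite (addrAC z) ![sqnorm (_ + s *: _)]sqnormD sqnormZ dotDl dotZl !dotZr.
rewrite -subr_ge0 !(dotBl, dotBr, dotZl) !(dotC a) => H.
by apply: le_trans H _; rewrite le_eqVlt; apply/orP; left; apply/eqP; field.
Qed.

(** The subgradient inequality gives Fenchel equality for [y] and [z]. For other [y'], Fenchel's
    inequality at the same [z] bounds [g y'] from below; since [y + a = eta *: (w - z)], the terms
    linear in [y' - y] cancel and quadratic growth is left. *)
Lemma prox_dual_strong_min z (y := eta *: (w - z) - a) : argmin Z F z ->
  exists2 s, G y = s%:E &
    forall y', ((s + 1 / (2 * eta) * sqnorm (y' - y))%:E <= G y')%E.
Proof.
move=> /[dup] -[Zz _] /prox_subgradient [t hz sub].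
have gy : g y = (dot y z - t)%:E.
  apply/eqP; rewrite eq_le (conjugate_on_ge y Zz hz) andbT.
  apply/conjugate_on_leP => z' t' Zz' /(sub _ _ Zz').
  by rewrite -/y dotBr; lra.
exists (dot y z - t - dot y w + 1 / (2 * eta) * sqnorm (y + a)).
  by rewrite /G gy -EFinB -EFinD.
move=> y'; apply: (@le_trans _ _ ((dot y' z - t)%:E - (dot y' w)%:E
    + (1 / (2 * eta) * sqnorm (y' + a))%:E)%E); last first.
  by rewrite !leeD2r// conjugate_on_ge.
rewrite -EFinB -EFinD lee_fin.
have -> : y' + a = (y + a) + (y' - y).
  by apply/matrixP => j k; rewrite !mxE; ring.
rewrite [sqnorm (y + a + _)]sqnormD.
have ya : y + a = eta *: (w - z) by rewrite /y subrK.
clearbody y; rewrite ya dotZl dotBl !dotBr.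
rewrite le_eqVlt; apply/orP; left; apply/eqP.
rewrite !(dotC w) !(dotC z); field; exact: lt0r_neq0.
Qed.

(* Moreau duality: the optimality condition of either problem says that
   [y] is a subgradient of [h + indicator Z] at [z]. *)
Lemma argmin_prox_dual z y : z = w - (1 / eta) *: (a + y) ->
  argmin Z F z <-> argmin setT G y.
Proof.
move=> zE; have yE : y = eta *: (w - z) - a.
  by rewrite zE subKr scalerA div1r divff ?lt0r_neq0// scale1r addrC addKr.
split=> [/prox_dual_strong_min [s]|[_ miny]].
  rewrite -yE => Gy minG; split => // y' _; rewrite Gy.
  apply: le_trans (minG y'); rewrite lee_fin lerDl.
  by rewrite mulr_ge0 ?sqnorm_ge0// divr_ge0// mulr_ge0// ltW.
have [z' z'min] := prox_exists.
have [s Gy' minG] := prox_dual_strong_min z'min.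
have := le_trans (minG y) (miny (eta *: (w - z') - a) I); rewrite Gy' lee_fin.
rewrite gerDl pmulr_rle0 ?divr_gt0 ?mulr_gt0// => /sqnorm_le0 /eqP.
rewrite subr_eq0 yE => /eqP /addIr /(scalerI (lt0r_neq0 eta_gt0)) /addrI.
by move=> /oppr_inj ->.
Qed.

End Prox.

(** The epigraph of [g] is an intersection of closed half-spaces, which gives closedness and
    convexity. *)
Lemma conjugate_on_proper_closed_convex : proper_closed_convex g.
Proof.
have epiE : epigraph g = \bigcap_(z in Z) \bigcap_(s in [set s | h z = s%:E])
    [set e : 'cV[R]_p * R^o | dot e.1 z - s <= e.2].
  apply/seteqP; split => [e /conjugate_on_leP He z Zz s hs|e He].
    exact: He hs.
  by apply/conjugate_on_leP => z s Zz hs; exact: (He z Zz s hs).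
split.
- split=> [y|].
    have [z [s [Zz hz]]] := domain_nonempty.
    by have := conjugate_on_ge y Zz hz; case: (g y).
  (* Any proximal point supplies a dual point where [g] is finite; the zero data and unit parameter
     are an arbitrary choice. *)
  have [z zmin] := prox_exists 0 0 ltr01.
  have [s Gs _] := prox_dual_strong_min ltr01 zmin.
  by exists (1 *: (0 - z) - 0) => gy; move: Gs; rewrite gy.
- rewrite epiE; apply: closed_bigI => z _; apply: closed_bigI => s _.
  have cf : continuous (fun e : 'cV[R]_p * R^o => dot e.1 z - s - e.2 : R).
    move=> e; apply: cvgB; last exact: cvg_snd.
    apply: cvgB; last exact: cvg_cst.
    exact: (continuous_comp cvg_fst (@continuous_dotl R p z _)).
  have -> : [set e : 'cV[R]_p * R^o | dot e.1 z - s <= e.2] =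
      (fun e : 'cV[R]_p * R^o => dot e.1 z - s - e.2 : R) @^-1` [set x | x <= 0].
    by apply/seteqP; split => e /=; rewrite subr_le0.
  exact: (closed_comp (fun e _ => cf e) (closed_le (y := 0))).
- apply/convex_set_lmodP => s x y s0 s1.
  rewrite /epigraph /= => /conjugate_on_leP Hx /conjugate_on_leP Hy.
  apply/conjugate_on_leP => z t Zz hz; rewrite dotDl !dotZl.
  have := Hx _ _ Zz hz; have := Hy _ _ Zz hz => h1 h2.
  have -> : s *: x.2 + (1 - s) *: y.2 = s * x.2 + (1 - s) * y.2 by [].
  have s1' : 0 <= 1 - s by rewrite subr_ge0.
  by have := lerD (ler_wpM2l s0 h2) (ler_wpM2l s1' h1); lra.
Qed.

End MoreauDuality.

(** * Transformations that preserve minimizers *)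

Section Argmin.
Context {R : realType}.

Lemma argmin_eq (T : Type) (S : set T) (F G : T -> \bar R) x :
  (forall x, S x -> F x = G x) -> argmin S F x <-> argmin S G x.
Proof.
move=> FG; split=> -[Sx minx]; split => // x' Sx'.
  by rewrite -!FG//; exact: minx.
by rewrite !FG//; exact: minx.
Qed.

Lemma argmin_addr (T : Type) (S : set T) (F : T -> \bar R) (c : R) x :
  argmin S F x <-> argmin S (fun x => F x + c%:E)%E x.
Proof.
by split=> -[Sx minx]; split => // x' /minx; rewrite leeD2rE.
Qed.

Lemma argmin_comp (T T' : Type) (f : T -> T') (S : set T') (G : T' -> \bar R) x :
  (forall v, exists u, f u = v) ->
  argmin (f @^-1` S) (G \o f) x <-> argmin S G (f x).
Proof.
move=> surj; split=> -[Sx minx]; split => // x'; last exact: minx.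
by have [u <-] := surj x'; exact: minx.
Qed.

End Argmin.

(** * The x-subproblem *)

Section BlockStep.
Context {R : realType} {p n : nat}.

(* The two objectives differ by a constant: the quadratic term in [M] of the
   augmented Lagrangian is cancelled by the proximal matrix, and its linear
   term turns the multiplier [z] into [z - (q / eta) *: r]. *)
Lemma argmin_block_step (M : 'M[R]_(p, n)) (S : set 'cV[R]_n)
    (u : 'cV[R]_n -> \bar R) (tau eta q : R) (x x' : 'cV[R]_n) (z r : 'cV[R]_p) :
  eta != 0 ->
  argmin S (fun xi => (dot (- (z - (q / eta) *: r)) (M *m xi))%:E + u xi
      + (tau / 2 * sqnorm (xi - x))%:E)%E x' <->
  argmin S (fun xi => (dot (- z) (M *m xi))%:E + u xi
      + (q / (2 * eta) * sqnorm (M *m (xi - x) + r))%:E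
      + (1 / 2 * wsqnorm (tau%:M - (q / eta) *: (M^T *m M)) (xi - x))%:E)%E x'.
Proof.
move=> eta0.
(* The terms free of [xi] left when the square around [r] is expanded. *)
pose c := q / (2 * eta) * sqnorm r - q / eta * dot r (M *m x).
rewrite (argmin_addr _ _ c); apply: argmin_eq => xi _.
case: (u xi) => [s| |] //; rewrite -!EFinD; congr _%:E.
rewrite wsqnorm_scalarB [sqnorm (_ + r)]sqnormD !mulmxBr.
rewrite !(dotNl, dotBl, dotBr, dotZl) /c.
by rewrite !(dotC r); field.
Qed.

End BlockStep.

(** * Block vectors and selection of a single block *)

Section BlockVectors.
Context {R : realType}.

Lemma dot_submxcol k (n : 'I_k -> nat) (v w : 'cV[R]_(\sum_j n j)) :
  dot v w = \sum_j dot (submxcol v j) (submxcol w j).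
Proof.
rewrite {1}/dot -{1}(submxcolK v) -{1}(submxcolK w) tr_mxcol mul_mxrow_mxcol.
by rewrite summxE.
Qed.

Lemma mul_mxrow_submxcol p k (n : 'I_k -> nat) (M : forall j, 'M[R]_(p, n j))
    (v : 'cV[R]_(\sum_j n j)) :
  \mxrow_j M j *m v = \sum_j M j *m submxcol v j.
Proof. by rewrite -{1}(submxcolK v) mul_mxrow_mxcol. Qed.

Lemma submxcol_surj k (n : 'I_k -> nat) j (v : 'cV[R]_(n j)) :
  exists w : 'cV[R]_(\sum_j n j), submxcol w j = v.
Proof.
exists (\mxcol_j' dfwith (fun j' => 0 : 'cV[R]_(n j')) j v j').
by rewrite mxcolK dfwithin.
Qed.

Lemma big_single k (V : nmodType) (F : 'I_k -> V) j0 :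
  (forall j, j = j0) -> \sum_j F j = F j0.
Proof.
by move=> jj0; rewrite (bigD1 j0)//= big1 ?addr0// => j; rewrite (jj0 j) eqxx.
Qed.

Context {N p : nat} {m : 'I_N -> nat} (A : forall i, 'M[R]_(p, m i)).
Implicit Types x : 'cV[R]_(\sum_i m i).

Lemma mxrow_update x x' i0 :
  (forall i, i <> i0 -> submxcol x' i = submxcol x i) ->
  \mxrow_i A i *m x' =
    \mxrow_i A i *m x + A i0 *m (submxcol x' i0 - submxcol x i0).
Proof.
move=> eqx; apply/eqP; rewrite addrC -subr_eq -mulmxBr mul_mxrow_submxcol.
rewrite [X in X == _](bigD1 i0)//= [X in _ + X == _]big1 ?addr0 ?submxcolB//.
move=> i /eqP ii0.
by rewrite submxcolB eqx// subrr mulmx0.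
Qed.

Section OneBlock.
Context (I : {set 'I_N}) (j0 : 'I_#|I|).
Hypothesis I1 : forall j, j = j0.

Lemma submat_single (xI : 'cV[R]_(\sum_(j < #|I|) m (enum_val j))) :
  submat I A *m xI = A (enum_val j0) *m submxcol xI j0.
Proof. by rewrite /submat mul_mxrow_submxcol (big_single _ I1). Qed.

Lemma sqnorm_single (xI : 'cV[R]_(\sum_(j < #|I|) m (enum_val j))) :
  sqnorm xI = sqnorm (submxcol xI j0).
Proof. by rewrite /sqnorm dot_submxcol (big_single _ I1). Qed.

Lemma submxcol_subvec x j : submxcol (subvec I x) j = submxcol x (enum_val j).
Proof. by rewrite /subvec mxcolK. Qed.

Lemma subvec0 : subvec I (0 : 'cV[R]_(\sum_i m i)) = 0.
Proof.
rewrite -[RHS]submxcolK; apply: eq_mxcol => j.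
by rewrite !submxcol0.
Qed.

(** Composing with the surjection onto block [j0] turns one objective into the other. Uniqueness of
    [j0], rather than an equation on the cardinal of [I], avoids casts between block sizes. *)
Lemma argmin_single_block (X : forall i, set 'cV[R]_(m i))
    (u : forall i, 'cV[R]_(m i) -> \bar R) (tau eta q : R) x x' (z r : 'cV[R]_p)
    (i0 := enum_val j0) :
  argmin (X i0) (fun xi => (dot (- z) (A i0 *m xi))%:E + u i0 xi
      + (q / (2 * eta) * sqnorm (A i0 *m (xi - submxcol x i0) + r))%:E
      + (1 / 2 * wsqnorm (tau%:M - (q / eta) *: ((A i0)^T *m A i0))
                   (xi - submxcol x i0))%:E)%E (submxcol x' i0) <->
  argmin [set xI | forall j : 'I_#|I|, X (enum_val j) (submxcol xI j)]
    (fun xI => (dot (subvec I (0 : 'cV[R]_(\sum_i m i)) - (submat I A)^T *m z) xI)%:E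
      + \sum_(j < #|I|) u (enum_val j) (submxcol xI j)
      + (q / eta / 2 * sqnorm (submat I A *m (xI - subvec I x) + r))%:E
      + (1 / 2 * wsqnorm (tau%:M - (q / eta) *: ((submat I A)^T *m submat I A))
                   (xI - subvec I x))%:E)%E (subvec I x').
Proof.
rewrite -[submxcol x' i0]submxcol_subvec.
have surj := @submxcol_surj _ (fun j : 'I_#|I| => m (enum_val j)) j0.
rewrite -(argmin_comp _ _ _ surj) /=.
have -> : [set xI : 'cV[R]_(\sum_(j < #|I|) m (enum_val j)) |
      forall j : 'I_#|I|, X (enum_val j) (submxcol xI j)] =
    (fun xI : 'cV[R]_(\sum_(j < #|I|) m (enum_val j)) => submxcol xI j0) @^-1` X i0.
  by apply/seteqP; split => xI /= H; [exact: H|move=> j; rewrite (I1 j)].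
apply: argmin_eq => xI _ /=.
rewrite subvec0 add0r !dotNl dot_trmx_mul !wsqnorm_scalarB !submat_single.
rewrite (big_single _ I1) sqnorm_single submxcolB submxcol_subvec.
by have -> : q / eta / 2 = q / (2 * eta) by rewrite invfM mulrA mulrAC.
Qed.

End OneBlock.

(** The cardinal of a singleton equals 1 only propositionally, so its sole index comes with a
    uniqueness property. *)
Lemma set1_index (j0 : 'I_N) : exists2 j : 'I_#|[set j0]%SET|,
  enum_val j = j0 & forall j', j' = j.
Proof.
have j : 'I_#|[set j0]%SET| by rewrite cards1; exact: ord0.
exists j; first by apply/set1P; exact: enum_valP.
move=> j'; apply: ord_inj.
have := ltn_ord j; have := ltn_ord j'; rewrite {2 4}cards1.
by case: (nat_of_ord j) => [|//]; case: (nat_of_ord j').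
Qed.

Lemma argmin_set1_block (X : forall i, set 'cV[R]_(m i))
    (u : forall i, 'cV[R]_(m i) -> \bar R) (tau eta q : R) (i0 : 'I_N)
    x x' (z r : 'cV[R]_p) :
  argmin (X i0) (fun xi => (dot (- z) (A i0 *m xi))%:E + u i0 xi
      + (q / (2 * eta) * sqnorm (A i0 *m (xi - submxcol x i0) + r))%:E
      + (1 / 2 * wsqnorm (tau%:M - (q / eta) *: ((A i0)^T *m A i0))
                   (xi - submxcol x i0))%:E)%E (submxcol x' i0) <->
  argmin [set xI | forall j : 'I_#|[set i0]%SET|, X (enum_val j) (submxcol xI j)]
    (fun xI => (dot (subvec [set i0] (0 : 'cV[R]_(\sum_i m i))
                  - (submat [set i0] A)^T *m z) xI)%:E
      + \sum_(j < #|[set i0]%SET|) u (enum_val j) (submxcol xI j)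
      + (q / eta / 2 * sqnorm (submat [set i0] A *m (xI - subvec [set i0] x) + r))%:E
      + (1 / 2 * wsqnorm (tau%:M - (q / eta)
                     *: ((submat [set i0] A)^T *m submat [set i0] A))
                   (xI - subvec [set i0] x))%:E)%E (subvec [set i0] x').
Proof.
have [j0 j0E j1] := set1_index i0.
have := argmin_single_block j1 X u tau eta q x x' z r.
by rewrite j0E.
Qed.

End BlockVectors.

Lemma grad_cst (R : realType) n (c : R) (v : 'cV[R]_n) : grad (fun=> c) v = 0.
Proof. by apply/matrixP => j k; rewrite !mxE derive_cst. Qed.

(** * Equivalence of the update rules for one sequence of selections *)

Section Updates.
Context {R : realType} {N p : nat} {m : 'I_N -> nat}.
Context (A : forall i, 'M[R]_(p, m i)) (X : forall i, set 'cV[R]_(m i)).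
Context (u : forall i, 'cV[R]_(m i) -> \bar R).
Context (Z : set 'cV[R]_p) (h : 'cV[R]_p -> \bar R) (tau eta q : R).
Hypotheses (hZ : closed_convex_set Z) (hh : proper_closed_convex h)
  (hhZ : proper_ext (fun z => h z + indicator Z z)%E) (eta_gt0 : 0 < eta).
Context (i : nat -> 'I_N) (x : nat -> 'cV[R]_(\sum_i m i)).
Implicit Types (y z zbar r rhalf : nat -> 'cV[R]_p).
Let Ax k := \mxrow_j A j *m x k.

(** Under the two linking relations the updates correspond line by line, through [argmin_block_step]
    for x and Moreau duality for z and y. *)
Lemma primal_dual_split_updates y z zbar :
  (forall k, zbar k = z k - (q / eta) *: (Ax k + y k)) ->
  (forall k, z k.+1 = z k - (1 / eta) *: (Ax k.+1 + y k.+1)) ->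
  primal_dual_updates A X u Z h tau eta q i x z zbar <->
  split_updates A X u Z h tau eta q i x y z.
Proof.
move=> zbarE zE; have eta0 := lt0r_neq0 eta_gt0.
have prox k := argmin_prox_dual hZ hh hhZ eta_gt0 (zE k).
split=> [H r k|H k]; have [h1 h2 h3 h4] := H k; split => //.
- by apply/(argmin_block_step _ _ _ _ _ _ _ _ _ eta0); rewrite -zbarE.
- exact/prox.
- by rewrite zbarE; apply/(argmin_block_step _ _ _ _ _ _ _ _ _ eta0).
- exact/prox.
(* The residual is [eta] times the decrease of [z], so its multiple by [q / eta] is the
   extrapolation term. *)
- rewrite zbarE; have -> : Ax k.+1 + y k.+1 = eta *: (z k - z k.+1).
    by rewrite zE subKr scalerA div1r divff// scale1r.
  rewrite scalerA divfK// addrC; congr (_ + _).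
  by rewrite -scalerN opprB.
Qed.

Let pb := TwoBlockProblem (fun=> 0) u X A (fun=> 0) (conjugate_on Z h) setT 1%:M 0.
Let I k := [set i k]%SET.
Let P k := tau%:M - (q / eta) *: ((submat (I k) A)^T *m submat (I k) A).
Let rpdbu := rpdbu_updates pb (q / eta) (1 / eta) (1 / eta) (I := I) P (fun=> 0).

Lemma submat_set1_update k :
  (forall j, j <> i k -> submxcol (x k.+1) j = submxcol (x k) j) ->
  submat (I k) A *m (subvec (I k) (x k.+1) - subvec (I k) (x k)) = Ax k.+1 - Ax k.
Proof.
move=> /(mxrow_update A); rewrite /Ax => ->; have [j0 j0E j1] := set1_index (i k).
rewrite (submat_single _ j1) submxcolB !submxcol_subvec.
by rewrite j0E addrAC subrr add0r.
Qed.

(** By induction, the incremental updates telescope from the exact initial residual; the half step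
    sees the new [x] and the old [y]. *)
Lemma rpdbu_residual y z r rhalf : rpdbu x y z r rhalf ->
  (forall k, r k = Ax k + y k) /\ (forall k, rhalf k = Ax k.+1 + y k).
Proof.
move=> [r0 H].
have rhE k : r k = Ax k + y k -> rhalf k = Ax k.+1 + y k.
  have [_ h2 _ -> _] := H k => ->; rewrite /= submat_set1_update.
    by rewrite addrC addrA subrK.
  by move=> j ji; apply: h2; rewrite inE; apply/eqP.
have rE k : r k = Ax k + y k.
  elim: k => [|k /rhE IH]; first by rewrite r0 /= mul1mx subr0.
  have [_ _ _ _ [_ -> _]] := H k; rewrite IH /= mul1mx.
  by rewrite -addrA (addrC (y k)) subrK.
by split=> // k; exact: rhE.
Qed.

(** Closed-form residuals reduce the x-step to [argmin_set1_block]; in the y-step the old [y]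
    cancels and [ups - y k + rhalf k] becomes [ups + Ax k.+1]. *)
Lemma split_rpdbu_updates y z r rhalf :
  (forall k, r k = Ax k + y k) -> (forall k, rhalf k = Ax k.+1 + y k) ->
  split_updates A X u Z h tau eta q i x y z <-> rpdbu x y z r rhalf.
Proof.
move=> rE rhE.
have block k := argmin_set1_block A X u tau eta q (i k) (x k) (x k.+1) (z k) (r k).
have ystep k : argmin setT
    (fun ups => (conjugate_on Z h ups - (dot ups (z k))%:E
      + (1 / (2 * eta) * sqnorm (ups + Ax k.+1))%:E)%E) (y k.+1) <->
  argmin (tb_Y pb)
    (fun ups => ((dot (grad (tb_g0 pb) (y k) - (tb_B pb)^T *m z k) ups)%:E
      + tb_v pb ups
      + (1 / eta / 2 * sqnorm (tb_B pb *m (ups - y k) + rhalf k))%:E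
      + (1 / 2 * wsqnorm 0 (ups - y k))%:E)%E) (y k.+1).
  apply: argmin_eq => ups _ /=.
  rewrite grad_cst sub0r trmx1 !mul1mx wsqnorm0 mulr0 adde0 rhE.
  congr (_ + _)%E; first by rewrite dotNl EFinN addeC dotC.
  have -> : ups - y k + (Ax k.+1 + y k) = ups + Ax k.+1.
    by rewrite (addrC (Ax _)) addrA subrK.
  by have -> : 1 / eta / 2 = 1 / (2 * eta) by rewrite invfM mulrA mulrAC.
split=> [H|[_ H]].
  split; first by rewrite rE /= mul1mx subr0.
  move=> k; have [h1 h2 h3 h4] := H k; split.
  - by rewrite trmx0 /P linearB /= tr_scalar_mx linearZ /= trmx_mul trmxK.
  - by move=> j; rewrite inE => /eqP; exact: h2.
  - by rewrite grad_cst; apply/block; rewrite rE.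
  - rewrite rE rhE /= submat_set1_update//.
    by rewrite [RHS]addrAC [X in _ = X + _]addrC subrK.
  - split; [exact/ystep| |by rewrite rE].
    by rewrite rE rhE /= mul1mx -addrA (addrC (y k)) subrK.
move=> k; have [_ h2 h3 _ [h4 _ h5]] := H k; split.
- by move: h3; rewrite grad_cst => /block; rewrite rE.
- by move=> j ji; apply: h2; rewrite inE; apply/eqP.
- exact/ystep.
- by rewrite h5 rE.
Qed.

End Updates.

(** * Uniform selection of an index and of a singleton *)

Section Selection.
Context {R : realType} {d : measure_display} {Omega : measurableType d}.
Context (Pr : probability Omega R).

(** Forming singletons is a bijection from [T] onto the one-element sets, so trajectory events and
    cardinalities coincide. *)
Lemma uniform_selection_set1 (T : finType) (S : nat -> Omega -> T) :
  uniform_selection Pr [set: T]%SET S <->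
  uniform_selection Pr [set J : {set T} | #|J| == 1%N]%SET
    (fun k w => [set S k w]%SET).
Proof.
have cardE : #|[set J : {set T} | #|J| == 1%N]%SET| = #|[set: T]%SET|.
  by rewrite card_draws cardsT bin1.
have preE k t : [set w | [set S k w]%SET = [set t]%SET] = [set w | S k w = t].
  by apply/seteqP; split => w /=; [exact: set1_inj|move=> ->].
split=> -[_ mS PrS]; split.
- by move=> k w; rewrite inE cards1.
- move=> k J; have [[t ->]|nJ] := pselect (exists t, J = [set t]%SET).
    by rewrite preE.
  rewrite [X in measurable X](_ : _ = set0)//.
  by apply/seteqP; split => w //= SJ; apply: nJ; exists (S k w).
- move=> l s sE; have /choice[t tE] : forall k, exists t, s k = [set t]%SET.
    by move=> k; apply/cards1P; have := sE k; rewrite inE.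
  rewrite cardE -(PrS l t) => [|k]; last by rewrite inE.
  congr (Pr _); apply/seteqP; split => w /= H k kl; have := H k kl.
    by rewrite tE => /set1_inj.
  by rewrite tE => ->.
- by move=> k w; rewrite inE.
- by move=> k t; rewrite -preE.
- move=> l s _; have := PrS l (fun k => [set s k]%SET).
  rewrite cardE => <-; last by move=> k; rewrite inE cards1.
  congr (Pr _); apply/seteqP; split => w /= H k kl; have := H k kl.
    by move=> ->.
  by move/set1_inj.
Qed.

End Selection.

(** * Admissibility and equivalence of the random runs *)

Lemma smooth_convex0 (R : realType) (n : nat) :
  smooth_convex (fun _ : 'cV[R]_n => 0 : R).
Proof.
split=> [v|| t v w _ _]; first exact: differentiable_cst.
  by exists 0 => v w; rewrite !grad_cst subrr sqnorm0 mul0r.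
by rewrite convmm.
Qed.

Theorem proposition6p1 (R : realType)
  (d : measure_display) (Omega : measurableType d) (Pr : probability Omega R)
  (N p : nat) (m : 'I_N -> nat)
  (A : forall i, 'M[R]_(p, m i))
  (X : forall i, set 'cV[R]_(m i)) (Z : set 'cV[R]_p)
  (u : forall i, 'cV[R]_(m i) -> \bar R) (h : 'cV[R]_p -> \bar R)
  (tau eta q : R)
  (hX : forall i, closed_convex_set (X i))
  (hZ : closed_convex_set Z)
  (hu : forall i, proper_closed_convex (u i))
  (hh : proper_closed_convex h)
  (hhZ : proper_ext (fun z => h z + indicator Z z)%E)
  (tau_gt0 : 0 < tau) (eta_gt0 : 0 < eta) (q_gt0 : 0 < q)
  (x0 : 'cV[R]_(\sum_i m i)) (y0 z0 : 'cV[R]_p)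
  (i : nat -> Omega -> 'I_N)
  (x : nat -> Omega -> 'cV[R]_(\sum_i m i)) (z : nat -> Omega -> 'cV[R]_p) :
  let g := conjugate_on Z h in
  let zbar0 := z0 - (q / eta) *: (\mxrow_j A j *m x0 + y0) in
  let pb := TwoBlockProblem (fun=> 0) u X A (fun=> 0) g setT 1%:M 0 in
  let I := fun k w => [set i k w]%SET in
  (* one block, so that [submat (I k w) A] is the matrix A_{i_k} *)
  let P := fun k w =>
    tau%:M - (q / eta) *: ((submat (I k w) A)^T *m submat (I k w) A) in
  let rho_x := q / eta in
  let rho_y := 1 / eta in
  let rho := 1 / eta in
  let Q := fun _ _ => 0 in
  [/\ (exists zbar,
         primal_dual_run Pr A X u Z h tau eta q x0 z0 zbar0 i x z zbar)
      <-> (exists y, split_run Pr A X u Z h tau eta q x0 y0 z0 i x y z),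
      admissible pb
    & (exists zbar,
         primal_dual_run Pr A X u Z h tau eta q x0 z0 zbar0 i x z zbar)
      <-> (exists y r rhalf,
             rpdbu_run Pr pb 1 rho_x rho_y rho (I := I) P Q
               x0 y0 z0 x y z r rhalf)].
Proof.
move=> g zbar0 pb I P rho_x rho_y rho Q.
have eta0 := lt0r_neq0 eta_gt0.
have pd_split : (exists zbar,
    primal_dual_run Pr A X u Z h tau eta q x0 z0 zbar0 i x z zbar) <->
  (exists y, split_run Pr A X u Z h tau eta q x0 y0 z0 i x y z).
  split=> [[zbar [sel run]]|[y [sel run]]].
    (* The primal-dual scheme has no [y]: it is recovered by solving the multiplier update for it,
       with [y0] at index 0. *)
    pose y k w := if k is k'.+1 then
      eta *: (z k' w - z k w) - \mxrow_j A j *m x k w else y0.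
    exists y; split => // w; have [hx hz hzbar upd] := run w; split => //.
    have zE k : z k.+1 w =
        z k w - (1 / eta) *: (\mxrow_j A j *m x k.+1 w + y k.+1 w).
      by rewrite /y [_ *m _ + _]addrC subrK scalerA div1r mulVf// scale1r subKr.
    apply: ((primal_dual_split_updates (y := y^~ w) X u tau hZ hh hhZ eta_gt0
      (i^~ w) _ zE).1 upd).
    (* The invariant for [zbar] holds at 0 by the matching initialization, and later by the
       extrapolation rule. *)
    case=> [|k]; first by rewrite hzbar hz hx.
    have [_ _ _ ->] := upd k; rewrite /y [_ *m _ + _]addrC subrK scalerA divfK//.
    by rewrite addrC -scalerN opprB.
  pose zbar k w := z k w - (q / eta) *: (\mxrow_j A j *m x k w + y k w).
  exists zbar; split => // w; have [hx hy hz upd] := run w; split => //.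
    by rewrite /zbar hx hy hz.
  apply: ((primal_dual_split_updates (y := y^~ w) X u tau hZ hh hhZ eta_gt0
    (i^~ w) _ _).2 upd) => // k.
  by have [] := upd k.
split => //.
- split => //=; try exact: smooth_convex0.
    exact: conjugate_on_proper_closed_convex.
  by split=> //; split; [exact: closedT|move=> *; rewrite inE].
(* Only the split scheme remains to be compared with RPDBU: the residual witnesses are the closed
   forms, and [rpdbu_residual] shows that every run has these residuals. *)
rewrite pd_split; split=> [[y [sel run]]|[y [r [rhalf [sel run]]]]].
  exists y, (fun k w => \mxrow_j A j *m x k w + y k w),
    (fun k w => \mxrow_j A j *m x k.+1 w + y k w).
  split=> [|w]; first exact/uniform_selection_set1.
  have [hx hy hz upd] := run w; split => //.
  exact: (split_rpdbu_updates X u Z h tau eta q (i^~ w) (y := y^~ w) _ _ _).1 upd.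
exists y; split=> [|w]; first exact/uniform_selection_set1.
have [hx hy hz upd] := run w; split => //.
have [rE rhE] := rpdbu_residual upd.
exact: (split_rpdbu_updates X u Z h tau eta q _ _ rE rhE).2 upd.
Qed.
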